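(* For every integer $k\geq 2$ we have $\mathrm{ex}(n,C_3,\mathrm{rainbow}\text{-}C_{2k+1})=O\left(n^{1+1/k}\right)$ as $n\to\infty$; that is, there is a constant $c_k$ depending only on $k$ such that for every $n$, every $n$-vertex graph that admits a proper edge-coloring with no rainbow copy of the cycle $C_{2k+1}$ contains at most $c_k n^{1+1/k}$ triangles.
   Context: $C_m$ denotes the cycle with $m$ edges; $C_3$ is a triangle. A proper edge-coloring assigns colors to edges so that edges sharing a vertex get distinct colors. A copy of a graph in an edge-colored graph is rainbow if all its edges receive distinct colors. For graphs $F,H$, $\mathrm{ex}(n,F,\mathrm{rainbow}\text{-}H)$ is the maximum number of copies of $F$ in an $n$-vertex graph that has a proper edge-coloring containing no rainbow copy of $H$. *)

(* Defs.v *)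
From HB Require Import structures.
From mathcomp Require Import all_boot all_order all_algebra.
From mathcomp Require Import boolp.

Set Implicit Arguments.
Unset Strict Implicit.
Unset Printing Implicit Defensive.

(* A simple graph with vertex set T is represented by its set of edges, each
   edge being an unordered pair of distinct vertices. *)
Definition sgraph (T : finType) (E : {set {set T}}) : bool :=
  [forall A in E, #|A| == 2].

(* The cycle on 'I_m; it is a simple graph with m edges only if 3 <= m. *)
Definition cycle_graph (m : nat) : {set {set 'I_m}} :=
  [set [set i; ordS i] | i : 'I_m].

(* The copies of F in G are the subgraphs of G (pairs of a vertex set and an
   edge set) isomorphic to F, that is, the images of F under the injections
   that map edges of F to edges of G. *)
Definition copies (V T : finType) (F : {set {set V}}) (G : {set {set T}}) :
    {set {set T} * {set {set T}}} :=
  [set (f @: [set: V], [set f @: (A : {set V}) | A in F])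
     | f : {ffun V -> T} &
       injectiveb f && ([set f @: (A : {set V}) | A in F] \subset G)].

(* Only the values of c on the edges of G matter; as G is finite, taking nat
   as the set of colors is no restriction. *)
Definition proper_edge_coloring (T : finType) (G : {set {set T}})
    (c : {set T} -> nat) : Prop :=
  {in G &, forall A B, A != B -> A :&: B != set0 -> c A != c B}.

Definition has_rainbow_copy (V T : finType) (H : {set {set V}})
    (G : {set {set T}}) (c : {set T} -> nat) : Prop :=
  exists2 S, S \in copies H G & {in S.2 &, injective c}.

Definition rainbow_free_colorable (V T : finType) (H : {set {set V}})
    (G : {set {set T}}) : Prop :=
  exists2 c : {set T} -> nat,
    proper_edge_coloring G c & ~ has_rainbow_copy H G c.

(* ex(n, F, rainbow-H) *)
Definition rainbow_ex (n : nat) (U V : finType) (F : {set {set U}})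
    (H : {set {set V}}) : nat :=
  \max_(G : {set {set 'I_n}} | sgraph G && `[< rainbow_free_colorable H G >])
     #|copies F G|.

(* Main.v *)
(* First, the number of triangles is linear in the number of edges lying in
   triangles: otherwise some nonempty subgraph has all its edges in many
   triangles, and there a rainbow cycle is lengthened up to C_{2k+1} by
   repeatedly replacing an edge uv by a path uwv.

   Second, choose a random set Z of vertices and colours and keep the edges uv
   with u, v and the colour of uv in Z that lie in a triangle uvw such that w
   and the colours of uw, vw are not in Z. On average this keeps at least 1/64 of
   the edges lying in triangles, and a rainbow C_{2k} made of kept edges extends
   to a rainbow C_{2k+1}.

   Third, a properly coloured graph without rainbow C_{2k} has O(n^{1+1/k})
   edges. Pass to a subgraph of minimum degree > C n^{1/k} and weight a walk by
   the product of the inverse degrees of its vertices. If h_j is the weight of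
   closed walks of length 2j, then h_0 <= n, h_j >= 1 and h is log-convex, hence
   h_{k-1} <= n^{1/k} h_k. A closed walk of length 2k that is not a rainbow cycle
   has a rotation whose last vertex, or last edge, collides with its first k + 1
   vertices, or first k edges; as the colouring is proper, these k + 1 vertices
   leave only 2k + 1 possible last vertices. Splitting according to whether the
   numbers of walks completing the cycle are balanced bounds the weight of such
   walks by eps h_k + O(h_{k-1} / (eps C n^{1/k})), which is less than h_k / (2k). *)
Require Import Defs.
From HB Require Import structures.
From mathcomp Require Import all_boot all_order all_algebra.
From mathcomp Require Import boolp reals exp.
From mathcomp Require Import zify ring lra.

Set Implicit Arguments.
Unset Strict Implicit.
Unset Printing Implicit Defensive.

Import Order.TTheory GRing.Theory Num.Theory.

Local Open Scope ring_scope.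

(** * Weighted walks *)

Lemma cauchy_schwarz_sum (R : realFieldType) (I : finType) (w a b : I -> R) :
  (forall i, 0 <= w i) -> 0 < \sum_i w i * b i ^+ 2 ->
  (\sum_i w i * (a i * b i)) ^+ 2
    <= (\sum_i w i * a i ^+ 2) * (\sum_i w i * b i ^+ 2).
Proof.
move=> w_ge0; set A := \sum_i w i * a i ^+ 2.
set B := \sum_i w i * b i ^+ 2; set C := \sum_i w i * (a i * b i) => B_gt0.
suff: 0 <= B * (B * A - C ^+ 2) by rewrite pmulr_rge0 // subr_ge0 mulrC.
have -> : B * (B * A - C ^+ 2) = \sum_i w i * (B * a i - C * b i) ^+ 2.
  rewrite (eq_bigr (fun i => B ^+ 2 * (w i * a i ^+ 2)
    - 2 * B * C * (w i * (a i * b i)) + C ^+ 2 * (w i * b i ^+ 2))).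
    by rewrite big_split sumrB -!mulr_sumr /= -/A -/B -/C; ring.
  by move=> i _; ring.
by apply: sumr_ge0 => i _; rewrite mulr_ge0 ?sqr_ge0.
Qed.

(** The convex sequence [log h] lies, at [m], below its chord from [0] to [m.+1]; here this is
    stated without roots. *)
Lemma log_convex_ratio (R : realFieldType) (h : nat -> R) (m : nat) :
  (forall j, 0 < h j) -> (forall j, h j.+1 ^+ 2 <= h j * h j.+2) ->
  h m ^+ m.+1 <= h 0%N * h m.+1 ^+ m.
Proof.
move=> h_gt0 h_cvx; elim: m => [|m IHm]; first by rewrite expr1 expr0 mulr1.
rewrite -(ler_pM2l (exprn_gt0 m (h_gt0 m.+1))).
have -> : h m.+1 ^+ m * h m.+1 ^+ m.+2 = (h m.+1 ^+ 2) ^+ m.+1.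
  by rewrite -exprD -exprM; congr (_ ^+ _); rewrite mulnC; lia.
apply: (@le_trans _ _ ((h m * h m.+2) ^+ m.+1)).
  by rewrite lerXn2r ?h_cvx // nnegrE ?sqr_ge0 // ltW ?mulr_gt0.
rewrite exprMn mulrA [_ * h 0%N]mulrC ler_wpM2r // exprn_ge0 //.
exact: ltW.
Qed.

Lemma big_nil_tuple (R : nmodType) (T : finType) (F : seq T -> R) :
  \sum_(t : 0.-tuple T) F t = F [::].
Proof.
rewrite (bigD1 [tuple]) //= big1 ?addr0 // => t /eqP[]; exact: tuple0.
Qed.

Lemma big_cons_tuple (R : nmodType) (T : finType) (m : nat) (F : seq T -> R) :
  \sum_(t : m.+1.-tuple T) F t = \sum_x \sum_(u : m.-tuple T) F (x :: u).
Proof.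
rewrite pair_big /= (reindex (fun p : T * m.-tuple T => [tuple of p.1 :: p.2])) //=.
exists (fun t : m.+1.-tuple T => (thead t, [tuple of behead t])) => [[x u] _|t _] /=.
  by rewrite theadE; congr pair; apply: val_inj.
by rewrite -tuple_eta.
Qed.

Lemma big_cat_tuple (R : nmodType) (T : finType) (m n : nat) (F : seq T -> R) :
  \sum_(t : (m + n).-tuple T) F t
    = \sum_(u : m.-tuple T) \sum_(v : n.-tuple T) F (u ++ v).
Proof.
elim: m F => [|m IHm] F.
  by rewrite (big_nil_tuple (fun s => \sum_(v : n.-tuple T) F (s ++ v))).
rewrite addSn (big_cons_tuple (m + n)).
rewrite (big_cons_tuple _ (fun s : seq T => \sum_(v : n.-tuple T) F (s ++ v))).
by apply: eq_bigr => x _; rewrite (IHm (fun s => F (x :: s))).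
Qed.

Section Walks.

Variables (R : realFieldType) (T : finType) (e : rel T).
Hypothesis e_sym : symmetric e.

Definition deg (x : T) : R := #|[pred y | e x y]|%:R.

(* The inverse is 0 at isolated vertices, so that these carry no walk, not even
   one of length 0. *)
Definition weight (s : seq T) : R := \prod_(x <- s) (deg x)^-1.

(* The total weight of the walks of length [j] from [x] to [y], i.e. the (x, y)
   entry of D^-1 (A D^-1)^j for the adjacency matrix A and degree matrix D. *)
Fixpoint walk_weight (j : nat) (x y : T) : R :=
  if j is j'.+1 then (deg x)^-1 * \sum_(z | e x z) walk_weight j' z y
  else (x == y)%:R * (deg x)^-1.

(* Up to symmetry, the weight of the closed walks of length [2 * j]: the trace of
   (A D^-1)^(2j). *)
Definition closed_weight (j : nat) : R :=
  \sum_x \sum_y deg x * deg y * walk_weight j x y ^+ 2.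

Local Notation q := walk_weight.
Local Notation h := closed_weight.

Lemma deg_ge0 x : 0 <= deg x. Proof. exact: ler0n. Qed.

Lemma deg_sum x : deg x = \sum_(y | e x y) 1.
Proof. by rewrite /deg sumr_const. Qed.

Lemma deg_gt0 x y : e x y -> 0 < deg x.
Proof. by move=> exy; rewrite ltr0n; apply/card_gt0P; exists y. Qed.

Lemma weight_cons x s : weight (x :: s) = (deg x)^-1 * weight s.
Proof. by rewrite /weight big_cons. Qed.

Lemma weight_cat s t : weight (s ++ t) = weight s * weight t.
Proof. by rewrite /weight big_cat. Qed.

Lemma weight_rot i s : weight (rot i s) = weight s.
Proof. by apply: perm_big; rewrite perm_rot. Qed.

Lemma weight_ge0 s : 0 <= weight s.
Proof. by apply: prodr_ge0 => x _; rewrite invr_ge0 deg_ge0. Qed.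

Lemma weight_deg0 s x : x \in s -> deg x = 0 -> weight s = 0.
Proof.
by move=> xs dx0; rewrite /weight (big_rem x xs) /= dx0 invr0 mul0r.
Qed.

Lemma walk_weight_ge0 j x y : 0 <= q j x y.
Proof.
elim: j x => [|j IHj] x /=; first by rewrite mulr_ge0 ?ler0n ?invr_ge0 ?deg_ge0.
by rewrite mulr_ge0 ?invr_ge0 ?deg_ge0 ?sumr_ge0.
Qed.

Lemma walk_weight_deg0 j x y : deg x = 0 -> q j x y = 0.
Proof. by case: j => [|j] /= ->; rewrite invr0 (mulr0, mul0r). Qed.

Lemma walk_weightSr j x y :
  q j.+1 x y = (deg y)^-1 * \sum_(z | e z y) q j x z.
Proof.
elim: j x y => [|j IHj] x y.
  have sum_pick (P : pred T) (a : T) (F : T -> R) :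
      \sum_(z | P z) (z == a)%:R * F z = (P a)%:R * F a.
    rewrite big_mkcond (bigD1 a) //= big1 => [|z /negPf ->]; last first.
      by rewrite mul0r if_same.
    by rewrite eqxx addr0 mul1r; case: (P a); rewrite ?mul1r ?mul0r.
  rewrite /= (sum_pick (e x) y (fun z => (deg z)^-1)).
  have -> : \sum_(z | e z y) (x == z)%:R * (deg x)^-1
      = (e x y)%:R * (deg x)^-1.
    rewrite -(sum_pick (e^~ y) x (fun=> (deg x)^-1)).
    by apply: eq_bigr => z _; rewrite eq_sym.
  by set a := (deg x)^-1; set b := (deg y)^-1; ring.
transitivity ((deg x)^-1 * \sum_(z | e x z) q j.+1 z y); first by [].
under eq_bigr do rewrite IHj.
rewrite -mulr_sumr exchange_big /= mulrCA; congr (_ * _).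
by rewrite mulr_sumr.
Qed.

Lemma walk_weight_sym j x y : q j x y = q j y x.
Proof.
elim: j x y => [|j IHj] x y.
  by rewrite /= eq_sym; case: eqP => [->|]; rewrite ?mul0r.
rewrite walk_weightSr /=; congr (_ * _).
by apply: eq_big => [z|z _]; [apply: e_sym|apply: IHj].
Qed.

(** The middle vertex [z] is counted in both factors; [deg z] cancels one of its two inverse
    degrees. *)
Lemma walk_weightD i j x y : q (i + j) x y = \sum_z q i x z * deg z * q j z y.
Proof.
elim: i x => [|i IHi] x.
  rewrite add0n (bigD1 x) //= big1 => [|z]; last first.
    by rewrite eq_sym => /negPf ->; rewrite !mul0r.
  rewrite eqxx mul1r addr0; have [dx0|dx0] := eqVneq (deg x) 0.
    by rewrite (walk_weight_deg0 _ _ dx0) mulr0.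
  by rewrite mulVf // mul1r.
rewrite addSn /=; under eq_bigr do rewrite IHi.
rewrite exchange_big mulr_sumr /=; apply: eq_bigr => z _.
by rewrite -!mulr_suml !mulrA.
Qed.

(** Without the factor of its endpoint, the weight of a walk is the probability that the simple
    random walk from [x] follows it. *)
Lemma walk_weight_stochastic j x :
  \sum_y q j x y * deg y = (deg x != 0)%:R.
Proof.
elim: j x => [|j IHj] x.
  rewrite (bigD1 x) //= big1 => [|z]; last first.
    by rewrite eq_sym => /negPf ->; rewrite !mul0r.
  rewrite eqxx mul1r addr0; have [->|dx0] := eqVneq (deg x) 0.
    by rewrite mulr0.
  by rewrite mulVf.
rewrite /=; under eq_bigr do rewrite -mulrA mulr_suml.
rewrite -mulr_sumr exchange_big /=.
have [->|dx0] := eqVneq (deg x) 0; first by rewrite invr0 mul0r.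
rewrite (eq_bigr (fun=> 1)) => [|z exz]; last first.
  by rewrite IHj gt_eqF // (@deg_gt0 z x) // e_sym.
by rewrite -deg_sum mulVf.
Qed.

Lemma closed_weight_pair j :
  h j = \sum_(p : T * T) deg p.1 * deg p.2 * q j p.1 p.2 ^+ 2.
Proof. by rewrite /closed_weight pair_big. Qed.

(** The pairing depends only on [i + j]: the pairs [(j, j.+2)] and [(j.+1, j.+1)] give the same
    value, so Cauchy-Schwarz yields log-convexity. *)
Lemma walk_weight_trace i j :
  \sum_(p : T * T) deg p.1 * deg p.2 * (q i p.1 p.2 * q j p.1 p.2)
    = \sum_x deg x * q (i + j) x x.
Proof.
rewrite -(pair_big xpredT xpredT
  (fun x y => deg x * deg y * (q i x y * q j x y))) /=.
apply: eq_bigr => x _; rewrite walk_weightD mulr_sumr.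
by apply: eq_bigr => y _; rewrite (walk_weight_sym j y x); ring.
Qed.

Lemma closed_weightE j : h j = \sum_x deg x * q (j + j) x x.
Proof.
rewrite -walk_weight_trace closed_weight_pair.
by apply: eq_bigr => p _; rewrite expr2.
Qed.

Lemma closed_weight_ge0 j : 0 <= h j.
Proof.
rewrite closed_weight_pair; apply: sumr_ge0 => p _.
by apply: mulr_ge0; rewrite ?sqr_ge0 ?mulr_ge0 ?deg_ge0.
Qed.

Lemma closed_weight0 : h 0%N <= #|T|%:R.
Proof.
rewrite closed_weightE -sum1_card natr_sum.
apply: ler_sum => x _; rewrite /= eqxx mul1r.
have [->|dx0] := eqVneq (deg x) 0; first by rewrite mul0r ler01.
by rewrite mulfV.
Qed.

Hypothesis e_edge : exists x y, e x y.

(* Cauchy-Schwarz against the constant function 1; this is the weighted form of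
   hom(C_2j) >= (average degree)^2j. *)
Lemma closed_weight_ge1 j : 1 <= h j.
Proof.
have [x0 [y0 exy0]] := e_edge.
set m := \sum_x deg x.
have m_gt0 : 0 < m.
  rewrite /m (bigD1 x0) //=; apply: ltr_pwDl; first exact: deg_gt0 exy0.
  by apply: sumr_ge0 => x _; apply: deg_ge0.
have sum_deg : \sum_(p : T * T) deg p.1 * deg p.2 * 1 ^+ 2 = m ^+ 2.
  rewrite -(pair_big xpredT xpredT (fun x y => deg x * deg y * 1 ^+ 2)) /=.
  rewrite [m ^+ 2]expr2 {1}/m mulr_suml; apply: eq_bigr => x _.
  by rewrite mulr_sumr; apply: eq_bigr => y _; rewrite expr1n mulr1.
have sum_q : \sum_(p : T * T) deg p.1 * deg p.2 * (q j p.1 p.2 * 1) = m.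
  rewrite -(pair_big xpredT xpredT
    (fun x y => deg x * deg y * (q j x y * 1))) /=.
  apply: eq_bigr => x _.
  rewrite (eq_bigr (fun y => deg x * (q j x y * deg y))) => [|y _]; last by ring.
  rewrite -mulr_sumr walk_weight_stochastic.
  by have [->|] := eqVneq (deg x) 0; rewrite ?mulr0 ?mulr1.
have := @cauchy_schwarz_sum R _ (fun p : T * T => deg p.1 * deg p.2)
  (fun p => q j p.1 p.2) (fun=> 1).
rewrite sum_deg sum_q -closed_weight_pair => /(_ _ _)/wrap[].
- by move=> p; rewrite mulr_ge0 ?deg_ge0.
- by rewrite exprn_gt0.
by rewrite ler_pMl // exprn_gt0.
Qed.

Lemma closed_weight_log_convex j : h j.+1 ^+ 2 <= h j * h j.+2.
Proof.
rewrite [h j.+1]closed_weightE.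
have -> : (j.+1 + j.+1)%N = (j + j.+2)%N by lia.
rewrite -walk_weight_trace !closed_weight_pair.
apply: cauchy_schwarz_sum => [p|]; first by rewrite mulr_ge0 ?deg_ge0.
by rewrite -closed_weight_pair (lt_le_trans ltr01) ?closed_weight_ge1.
Qed.

(** The integer [nu] replaces a root of the number of vertices. In h_j^(j+1) <= h_0 h_(j+1)^j, bound
    h_0 by nu^(j+1), use h_(j+1) >= 1 and take roots. *)
Lemma closed_weight_step j (nu : nat) :
  (#|T| <= nu ^ j.+1)%N -> h j <= nu%:R * h j.+1.
Proof.
move=> T_nu; have h_gt0 i : 0 < h i by rewrite (lt_le_trans ltr01) ?closed_weight_ge1.
have nuh_ge0 : 0 <= nu%:R * h j.+1 by rewrite mulr_ge0 ?ler0n ?ltW.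
rewrite -(ler_pXn2r (ltn0Sn j)) ?nnegrE ?(ltW (h_gt0 _)) //.
apply: le_trans (log_convex_ratio _ h_gt0 closed_weight_log_convex) _.
rewrite exprMn -natrX ler_pM ?exprn_ge0 ?(ltW (h_gt0 _)) //.
  by apply: le_trans closed_weight0 _; rewrite ler_nat.
by rewrite exprS ler_peMl ?closed_weight_ge1 ?exprn_ge0 ?(ltW (h_gt0 _)).
Qed.

Lemma sum_walks j x (F : T -> R) :
  \sum_(u : j.-tuple T | path e x u) weight (x :: u) * F (last x u)
    = \sum_z q j x z * F z.
Proof.
rewrite big_mkcond /=; elim: j x => [|j IHj] x.
  rewrite (big_nil_tuple (fun s =>
    if path e x s then weight (x :: s) * F (last x s) else 0)) /=.
  rewrite [RHS](bigD1 x) //= big1 => [|z]; last first.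
    by rewrite eq_sym => /negPf ->; rewrite !mul0r.
  by rewrite !addr0 weight_cons /weight big_nil mulr1 eqxx mul1r.
rewrite (big_cons_tuple _ (fun s =>
  if path e x s then weight (x :: s) * F (last x s) else 0)) /=.
have -> : \sum_z q j.+1 x z * F z
    = \sum_y if e x y then (deg x)^-1 * \sum_z q j y z * F z else 0.
  rewrite -big_mkcond -mulr_sumr exchange_big mulr_sumr /=.
  by apply: eq_bigr => z _; rewrite -mulrA mulr_suml.
apply: eq_bigr => y _; case: (e x y); last by rewrite big1.
rewrite -IHj mulr_sumr; apply: eq_bigr => u _ /=.
by case: ifP; rewrite ?mulr0 // => _; rewrite weight_cons mulrA.
Qed.

End Walks.

Arguments walk_weight : simpl never.

(** * Closed walks of even length and the weight of the bad ones *)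

Section ClosedWalks.

Variables (R : realFieldType) (T : finType) (e : rel T).
Hypothesis e_sym : symmetric e.
Variables (bad : T -> seq T -> T -> bool) (m : nat).

Local Notation k := m.+1.
Local Notation q := (@walk_weight R T e).
Local Notation h := (@closed_weight R T e).
Local Notation d := (@deg R T e).
Local Notation w := (@weight R T e).

(* A closed walk is listed from its head [y]; its last vertex is adjacent to [y]
   and is tested against the walk of length [k] that starts at [y]. *)
Definition bad_walk (s : seq T) : bool :=
  if s is y :: p then bad y (take k p) (last y p) else false.

(** The walk is cut at the vertex reached after [k] steps. Badness sees the second half only through
    its last vertex [x], so that half sums to an entry of [q m]; the degree factor corrects for the
    cut vertex lying in both halves. *)
Lemma sum_bad_walks :
  \sum_(t : (k + m).+1.-tuple T | cycle e t && bad_walk t) w t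
    = \sum_y \sum_(u : k.-tuple T | path e y u)
        w (y :: u) * (d (last y u) *
          \sum_(x | e x y && bad y u x) q m (last y u) x).
Proof.
rewrite big_mkcond (big_cons_tuple _ (fun s =>
  if cycle e s && bad_walk s then w s else 0)) /=; apply: eq_bigr => y _.
rewrite (big_cat_tuple _ _ (fun s =>
  if path e y (rcons s y) && bad y (take k s) (last y s)
  then w (y :: s) else 0)) [RHS]big_mkcond /=; apply: eq_bigr => u _.
set z := last y u.
have [yu|yu] := ifP; last first.
  by apply: big1 => v _; rewrite rcons_cat cat_path yu.
transitivity (w (y :: u) * d z * \sum_(v : m.-tuple T | path e z v)
    w (z :: v) * (e (last z v) y && bad y u (last z v))%:R); last first.
  rewrite (@sum_walks R T e m z (fun x => (e x y && bad y u x)%:R)) -mulrA.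
  congr (_ * (_ * _)); rewrite [RHS]big_mkcond.
  by apply: eq_bigr => x _; case: ifP; rewrite (mulr1, mulr0).
rewrite [in RHS]big_mkcond mulr_sumr; apply: eq_bigr => v _ /=.
rewrite rcons_cat cat_path yu rcons_path last_cat -/z /=.
have -> : take k (u ++ v) = u by rewrite take_size_cat ?size_tuple.
case: (path e z v) => /=; last by rewrite mulr0.
case: (_ && _); last by rewrite !mulr0.
rewrite mulr1 -cat_cons weight_cat [w (z :: v)]weight_cons.
have [dz0|dz0] := eqVneq (d z) 0; last by rewrite -mulrA mulVKf.
by rewrite (@weight_deg0 R T e (y :: u) z) ?mul0r ?mem_last.
Qed.

Hypothesis bad_card : forall (y : T) (u : k.-tuple T), path e y u ->
  (#|[pred x | e x y && bad y u x]| <= (2 * k).+1)%N.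
Variable delta : R.
Hypothesis delta_gt0 : 0 < delta.
Hypothesis delta_min : forall x y, e x y -> delta <= d x.

(* Write [y] for the head, [z] for the vertex after [k] steps and [x] for the
   last vertex. If [q m z x <= mu * d y * q k y z], sum over the few bad [x];
   otherwise forget badness and bound [q k y z] by [q m z x / (mu * d y)]. *)
Lemma bad_walks_le (mu : R) : 0 < mu ->
  \sum_(t : (k + m).+1.-tuple T | cycle e t && bad_walk t) w t
    <= (2 * k).+1%:R * mu * h k + (mu * delta)^-1 * h m.
Proof.
move=> mu_gt0; rewrite sum_bad_walks.
pose s : R := (2 * k).+1%:R.
pose big y z x := mu * d y * q k y z < q m z x.
pose G y z := s * (mu * d y * q k y z) +
  \sum_(x | e x y && big y z x) q m z x.
have q_ge0 := @walk_weight_ge0 R T e; have d_ge0 := @deg_ge0 R T e.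
have mudq_ge0 y z : 0 <= mu * d y * q k y z.
  by apply: mulr_ge0 (q_ge0 _ _ _); apply: mulr_ge0 => //; apply: ltW.
apply: (@le_trans _ _ (\sum_y \sum_z q k y z * (d z * G y z))).
  apply: ler_sum => y _.
  rewrite -(@sum_walks R T e k y (fun z => d z * G y z)).
  apply: ler_sum => u yu; set z := last y u.
  apply: ler_wpM2l; first exact: weight_ge0.
  apply: ler_wpM2l => //; rewrite /G.
  apply: (@le_trans _ _ (\sum_(x | e x y && bad y u x)
      (mu * d y * q k y z + if big y z x then q m z x else 0))).
    apply: ler_sum => x _; case: ifPn => [_|]; first by rewrite lerDr.
    by rewrite /big -leNgt addr0.
  rewrite big_split /= sumr_const -mulr_natl; apply: lerD.
    by apply: ler_wpM2r; rewrite ?mudq_ge0 // /s ler_nat; apply: bad_card yu.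
  rewrite !big_mkcondr /= [leLHS]big_mkcond [leRHS]big_mkcond /=.
  apply: ler_sum => x _; case: (e x y) => //; case: (bad y u x) => //.
  by case: ifP.
have -> : \sum_y \sum_z q k y z * (d z * G y z) = s * mu * h k +
    \sum_y \sum_z q k y z * (d z * \sum_(x | e x y && big y z x) q m z x).
  rewrite /closed_weight mulr_sumr -big_split; apply: eq_bigr => y _ /=.
  rewrite mulr_sumr -big_split; apply: eq_bigr => z _ /=.
  by rewrite /G; ring.
rewrite lerD2l.
apply: (@le_trans _ _ (\sum_y \sum_z \sum_(x | e x y)
    (mu * delta)^-1 * (d z * q m z x ^+ 2))).
  apply: ler_sum => y _; apply: ler_sum => z _.
  rewrite !mulr_sumr big_mkcondr /=; apply: ler_sum => x exy.
  have del_y : delta <= d y by rewrite (@delta_min y x) // e_sym.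
  case: ifP => [qlt|_]; last first.
    apply: mulr_ge0; first by rewrite invr_ge0 mulr_ge0 // ltW.
    by apply: mulr_ge0 => //; apply: sqr_ge0.
  rewrite ler_pdivlMl ?mulr_gt0 //.
  have -> : mu * delta * (q k y z * (d z * q m z x))
      = (d z * q m z x) * (mu * delta * q k y z) by ring.
  have -> : d z * q m z x ^+ 2 = (d z * q m z x) * q m z x by ring.
  apply: ler_wpM2l; first by rewrite mulr_ge0.
  apply: le_trans (ltW qlt).
  by rewrite ler_wpM2r // ler_wpM2l // ltW.
(* For fixed [z] and [x] there are [d x] choices of [y], which restores the weight [d z * d x] in
   [h m]. *)
rewrite exchange_big /= /closed_weight mulr_sumr; apply: ler_sum => z _.
rewrite mulr_sumr; under eq_bigr do rewrite big_mkcond /=.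
rewrite exchange_big /=; apply: ler_sum => x _.
rewrite -big_mkcond /= sumr_const -mulr_natl -/(d x) le_eqVlt.
by apply/orP; left; apply/eqP; ring.
Qed.

End ClosedWalks.

(** With [mu] = 1 / (4 k s), the first term of [bad_walks_le] contributes h / 2 to 2 k N, and the
    second at most X h / 2, where X = 16 k^2 s nu / D < 1. *)
Lemma bad_share_lt (R : realFieldType) (k s nu D h h' N : R) :
  0 < k -> 0 < s -> 0 < D -> 0 < h -> 16 * k ^+ 2 * s * nu < D ->
  h' <= nu * h ->
  N <= s * (4 * k * s)^-1 * h + ((4 * k * s)^-1 * D)^-1 * h' ->
  2 * k * N < h.
Proof.
move=> k_gt0 s_gt0 D_gt0 h_gt0 D_gt h'_le N_le.
have [k_neq0 s_neq0 D_neq0] : [/\ k != 0, s != 0 & D != 0].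
  by rewrite !gt_eqF.
pose X := (16 * k ^+ 2 * s * nu) / D.
have X_lt : X < 1 by rewrite ltr_pdivrMr // mul1r.
apply: (@le_lt_trans _ _ ((1 + X) / 2 * h)); last first.
  by rewrite gtr_pMl // ltr_pdivrMr // mul1r; lra.
have -> : (1 + X) / 2 * h = 2 * k * (s * (4 * k * s)^-1 * h +
    ((4 * k * s)^-1 * D)^-1 * (nu * h)).
  by rewrite /X; field; rewrite ?k_neq0 ?s_neq0.
apply: ler_wpM2l; first by rewrite mulr_ge0 // ltW.
apply: le_trans N_le _; rewrite lerD2l ler_wpM2l // invr_ge0 mulr_ge0 ?ltW //.
by rewrite invr_gt0 !mulr_gt0.
Qed.

(* If every closed walk had a bad rotation, the at most [2 * k] rotations would give
   h k <= 2 k N with N the weight of the bad walks, contradicting [bad_share_lt]. *)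
Lemma exists_good_closed_walk (T : finType) (e : rel T) (m nu D : nat)
    (bad : T -> seq T -> T -> bool) :
  symmetric e -> (exists x y, e x y) ->
  (forall (y : T) (u : m.+1.-tuple T), path e y u ->
     (#|[pred x | e x y && bad y u x]| <= (2 * m.+1).+1)%N) ->
  (#|T| <= nu ^ m.+1)%N ->
  (16 * m.+1 ^ 2 * (2 * m.+1).+1 * nu < D)%N ->
  (forall x y, e x y -> (D <= #|[pred z | e x z]|)%N) ->
  exists2 s : seq T, size s = (2 * m.+1)%N /\ cycle e s &
    forall i, (i < size s)%N -> ~~ bad_walk bad m (rot i.+1 s).
Proof.
move=> e_sym e_edge bad_card T_nu D_gt D_min.
have D_gt0 : (0 < D)%N by lia.
pose K := (m.+1 + m).+1.
have K2 : K = (2 * m.+1)%N by rewrite /K; lia.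
pose w := @weight rat T e; pose h := @closed_weight rat T e.
(* With a test that is always true, [sum_bad_walks] runs over all closed walks, and its inner sum
   amounts to one more step of the walk. *)
have sum_closed : h m.+1 = \sum_(t : K.-tuple T | cycle e t) w t.
  transitivity (\sum_(t : K.-tuple T |
      cycle e t && bad_walk (fun _ _ _ => true) m t) w t); last first.
    apply: eq_bigl => t; case: t => [[|y p]] //= sz.
    by rewrite andbT.
  rewrite sum_bad_walks /h /closed_weight; apply: eq_bigr => y _.
  rewrite (@sum_walks _ _ _ m.+1 y (fun z => deg rat e z *
     \sum_(x | e x y && true) walk_weight rat e m z x)).
  apply: eq_bigr => z _.
  have -> : \sum_(x | e x y && true) walk_weight rat e m z x
      = deg rat e y * walk_weight rat e m.+1 y z.
    rewrite (@walk_weight_sym rat T e e_sym) walk_weightSr.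
    rewrite (eq_bigl (e^~ y)) => [|x]; last by rewrite andbT.
    have [dy0|dy0] := eqVneq (deg rat e y) 0; last by rewrite mulVKf.
    rewrite dy0 mul0r big_pred0 // => x; apply/negP => exy.
    by have := @deg_gt0 rat T e y x; rewrite e_sym exy dy0 ltxx => /(_ isT).
  by ring.
pose s : rat := (2 * m.+1).+1%:R.
pose mu : rat := (4 * m.+1%:R * s)^-1.
pose N0 := \sum_(t : K.-tuple T | cycle e t && bad_walk bad m t) w t.
have h_gt0 : 0 < h m.+1 by rewrite (lt_le_trans ltr01) ?closed_weight_ge1.
have N0_small : K%:R * N0 < h m.+1.
  have mu_gt0 : 0 < mu by rewrite invr_gt0 !mulr_gt0 ?ltr0n.
  have D_gt0' : 0 < D%:R :> rat by rewrite ltr0n.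
  have D_min' x y : e x y -> D%:R <= deg rat e x.
    by move=> exy; rewrite ler_nat (D_min x y).
  have N0_le := bad_walks_le e_sym bad_card D_gt0' D_min' mu_gt0.
  have h_step := closed_weight_step rat e_sym e_edge T_nu.
  have -> : K%:R = 2 * m.+1%:R :> rat by rewrite K2 natrM.
  apply: (bad_share_lt _ _ D_gt0' h_gt0 _ h_step N0_le).
  - exact: ltr0Sn.
  - exact: ltr0Sn.
  - by move: D_gt; rewrite -(ltr_nat rat) !natrM expr2.
have [|no_good] := pselect (exists2 t : K.-tuple T, cycle e t &
    forall i, (i < K)%N -> ~~ bad_walk bad m (rot i.+1 t)).
  by move=> [t ct t_good]; exists t; rewrite size_tuple // K2.
suff : h m.+1 <= K%:R * N0 by rewrite leNgt N0_small.
(* Rotation permutes the closed walks and keeps their weight, so [K%:R * N0] counts each of them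
   once for every bad rotation. *)
have N0_rot i : N0 = \sum_(t : K.-tuple T | cycle e t && bad_walk bad m (rot i t)) w t.
  rewrite /N0 (reindex_inj (h := fun t : K.-tuple T => [tuple of rot i t])) /=; last first.
    by move=> t t' /(congr1 val) /rot_inj /val_inj.
  by apply: eq_big => t; rewrite ?rot_cycle // => _; apply: weight_rot.
rewrite mulr_natl -[K in N0 *+ K]card_ord -sumr_const.
under eq_bigr => i _ do rewrite (N0_rot i.+1) big_mkcondr /=.
rewrite exchange_big sum_closed /=; apply: ler_sum => t ct.
have [i bad_i] : exists i : 'I_K, bad_walk bad m (rot i.+1 t).
  apply: contrapT => no_bad; apply: no_good; exists t => // i iK.
  by apply/negP => bad_i; apply: no_bad; exists (Ordinal iK).
rewrite (bigD1 i) //= bad_i lerDl sumr_ge0 // => j _.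
by case: ifP => // _; apply: weight_ge0.
Qed.

(** * Rotations of lists *)

Lemma nth_rot (T : Type) (x0 : T) (s : seq T) (n i : nat) :
  (n <= size s)%N -> (i < size s)%N ->
  nth x0 (rot n s) i = nth x0 s (if (n + i < size s)%N then n + i else n + i - size s)%N.
Proof.
move=> ns si; rewrite /rot nth_cat size_drop ltn_subRL.
case: ifP => ni; first by rewrite nth_drop.
rewrite nth_take; last lia.
by congr nth; lia.
Qed.

(** Two equal entries cut the cyclic list into two arcs, one of length at most [k]. Rotating the
    start of that arc to the last place puts its end among the first [k] entries. *)
Lemma uniq_rot_last (T : eqType) (x0 : T) (k : nat) (s : seq T) :
  (size s <= 2 * k)%N ->
  (forall i, (i < size s)%N -> last x0 (rot i.+1 s) \notin take k (rot i.+1 s)) ->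
  uniq s.
Proof.
move=> sk lastN; apply/negPn/negP => /(uniqPn x0)[i [j [ij js eq_ij]]].
suff [r [n [rs nk ns nth_rn]]] : exists r n, [/\ r < size s, n < k, n < size s &
    nth x0 (rot r.+1 s) n = nth x0 s r]%N.
  have /negP[] := lastN r rs.
  have -> : last x0 (rot r.+1 s) = nth x0 s r.
    rewrite -nth_last size_rot nth_rot //; last lia.
    by case: ifP => ?; congr nth; lia.
  by rewrite -nth_rn -(nth_take x0 nk) mem_nth // size_take size_rot; case: ifP.
have [jik|jik] := leqP (j - i) k.
  exists i, (j - i).-1; split; try lia.
  by rewrite nth_rot ?eq_ij; [case: ifP => ?; congr nth; lia|lia|lia].
exists j, (size s - j.+1 + i)%N; split; try lia.
by rewrite nth_rot -?eq_ij; [case: ifP => ?; congr nth; lia|lia|lia].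
Qed.

Local Close Scope ring_scope.

(** * Rainbow even cycles *)

Section Rainbow.

Variables (T : finType).
Implicit Types (E : {set {set T}}) (c : {set T} -> nat) (s p u : seq T).

Definition adj E (x y : T) : bool := [set x; y] \in E.

Definition path_colors c (x : T) p : seq nat :=
  pairmap (fun a b => c [set a; b]) x p.

Definition cycle_colors c s : seq nat :=
  if s is y :: p then path_colors c y (rcons p y) else [::].

Definition rainbow_cycle E c s : bool :=
  [&& uniq s, cycle (adj E) s & uniq (cycle_colors c s)].

Lemma adj_sym E : symmetric (adj E).
Proof. by move=> x y; rewrite /adj setUC. Qed.

Lemma sgraph_sub E E' : E' \subset E -> sgraph E -> sgraph E'.
Proof.
by move=> /subsetP sub /forall_inP gE; apply/forall_inP => A /sub; apply: gE.
Qed.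

Lemma proper_sub E E' c : E' \subset E ->
  proper_edge_coloring E c -> proper_edge_coloring E' c.
Proof. by move=> /subsetP sub cE A B /sub AE /sub BE; apply: cE. Qed.

Lemma adj_neq E x y : sgraph E -> adj E x y -> x != y.
Proof. by move=> /forall_inP gE /gE; rewrite cards2; case: (x != y). Qed.

Lemma color_inj E c x x' y : sgraph E -> proper_edge_coloring E c ->
  adj E x y -> adj E x' y -> c [set x; y] = c [set x'; y] -> x = x'.
Proof.
move=> gE cE xy x'y cc; apply/eqP/negPn/negP => xx'.
have /negP[] : c [set x; y] != c [set x'; y]; last by rewrite cc.
apply: cE => //.
  apply: contra_neq xx' => eqS.
  have : x \in [set x'; y] by rewrite -eqS set21.
  by rewrite !inE (negPf (adj_neq gE xy)) orbF => /eqP.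
by apply/set0Pn; exists y; rewrite in_setI !set22.
Qed.

Lemma rainbow_cycle_sub E E' c s : E' \subset E ->
  rainbow_cycle E' c s -> rainbow_cycle E c s.
Proof.
move=> /subsetP sub /and3P[uniq_s cyc_s uniq_c]; apply/and3P; split=> //.
by apply: (sub_cycle _ cyc_s) => x y; apply: sub.
Qed.

Lemma size_cycle_colors c s : size (cycle_colors c s) = size s.
Proof. by case: s => //= y p; rewrite size_pairmap size_rcons. Qed.

Lemma path_colors_cat c x p u :
  path_colors c x (p ++ u) = path_colors c x p ++ path_colors c (last x p) u.
Proof. by rewrite /path_colors pairmap_cat. Qed.

Lemma path_colors_rcons c x p z :
  path_colors c x (rcons p z) = rcons (path_colors c x p) (c [set last x p; z]).
Proof. by rewrite -!cats1 path_colors_cat. Qed.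

Lemma cycle_colors_rot c i s : i <= size s ->
  cycle_colors c (rot i s) = rot i (cycle_colors c s).
Proof.
elim: i => [|i IHi] si; first by rewrite !rot0.
rewrite (rotS si).
have -> : rot i.+1 (cycle_colors c s) = rot 1 (rot i (cycle_colors c s)).
  by apply: rotS; rewrite size_cycle_colors.
rewrite -(IHi (ltnW si)).
case: (rot i s) => [|y [|z p]] //.
rewrite -[cycle_colors c [:: y, z & p]]/(c [set y; z] :: path_colors c z (rcons p y)).
by rewrite !rot1_cons rcons_cons [LHS]path_colors_rcons last_rcons.
Qed.

(* A smallest subgraph among those with more edges than [D] times their number of
   non-isolated vertices has no vertex of small degree. *)
Lemma exists_min_degree_subgraph E (D : nat) : D * #|T| < #|E| ->
  exists E', [/\ E' \subset E, E' != set0 &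
    {in cover E', forall x, D < #|[set A in E' | x \in A]|}].
Proof.
move=> E_gt; pose P E' := (E' \subset E) && (D * #|cover E'| < #|E'|).
have PE : P E.
  by rewrite /P subxx (leq_ltn_trans _ E_gt) // leq_mul2l max_card orbT.
case: (arg_minnP (fun E' : {set {set T}} => #|E'|) PE) => E' /andP[sub E'_gt] E'_min.
exists E'; split=> // [|x x_cover].
  by apply: contraTneq E'_gt => ->; rewrite cards0.
rewrite ltnNge; apply/negP => F_le; set F := [set A in E' | x \in A] in F_le.
have F_sub : F \subset E' by apply/subsetP => A; rewrite inE => /andP[].
have F_gt0 : 0 < #|F|.
  by have /bigcupP[A AE' xA] := x_cover; apply/card_gt0P; exists A; rewrite inE AE'.
have cardD : #|E' :\: F| = #|E'| - #|F|.
  by rewrite cardsD; move/setIidPr: F_sub => ->.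
have F_leE : #|F| <= #|E'| by apply: subset_leq_card.
(* Deleting [F] costs at most [D] edges and uncovers [x], so the defining inequality of [P]
   survives, against minimality. *)
have cover_sub : cover (E' :\: F) \subset cover E' :\ x.
  apply/subsetP => y /bigcupP[A]; rewrite !inE => /andP[xA AE'] yA.
  rewrite AE' /= in xA; rewrite (contraNneq _ xA) => [|<- //].
  by apply/bigcupP; exists A.
have le_cover := subset_leq_card cover_sub.
have card_cover : #|cover E'| = #|cover E' :\ x|.+1.
  by rewrite (cardsD1 x) x_cover.
have : P (E' :\: F).
  rewrite /P (subset_trans (subsetDl _ _) sub) /= cardD.
  have : D * #|cover (E' :\: F)| <= D * #|cover E' :\ x| by rewrite leq_mul2l le_cover orbT.
  by move: E'_gt F_le F_leE; rewrite card_cover mulnS; lia.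
by move=> /E'_min; rewrite cardD; lia.
Qed.

Lemma degree_le_neighbours E x : sgraph E ->
  #|[set A in E | x \in A]| <= #|[pred z | adj E x z]|.
Proof.
move=> /forall_inP gE.
apply: leq_trans (leq_imset_card (fun z => [set x; z]) [pred z | adj E x z]).
apply/subset_leq_card/subsetP => A; rewrite inE => /andP[AE].
have /cards2P[a [b [ab defA]]] := gE A AE; rewrite defA !inE => /orP[]/eqP xE.
  by apply/imsetP; exists b; rewrite ?inE /adj xE -?defA.
by apply/imsetP; exists a; rewrite ?inE /adj xE setUC -?defA // setUC.
Qed.

Lemma card_color_mem E c (y : T) (L : seq nat) :
  sgraph E -> proper_edge_coloring E c ->
  #|[pred x | adj E x y && (c [set x; y] \in L)]| <= size L.
Proof.
move=> gE cE; rewrite cardE -(size_map (fun x => c [set x; y])).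
apply: uniq_leq_size.
  rewrite map_inj_in_uniq ?enum_uniq // => x x'; rewrite !mem_enum.
  by move=> /andP[xy _] /andP[x'y _]; apply: color_inj gE cE xy x'y.
by move=> a /mapP[x]; rewrite mem_enum => /andP[_ xu] ->.
Qed.

Definition collides c (y : T) u (x : T) : bool :=
  (x \in y :: u) || (c [set x; y] \in path_colors c y u).

(** The list [y :: u] excludes at most [(size u).+1] vertices; by properness each of the [size u]
    colours excludes at most one neighbour of [y]. *)
Lemma card_collides E c y u : sgraph E -> proper_edge_coloring E c ->
  #|[pred x | adj E x y && collides c y u x]| <= (2 * size u).+1.
Proof.
move=> gE cE; pose P := [pred x | adj E x y && (c [set x; y] \in path_colors c y u)].
have P_le : #|P| <= size u.
  by rewrite -(size_pairmap (fun a b => c [set a; b]) y u); apply: card_color_mem.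
have U_le : #|y :: u| <= (size u).+1 by apply: card_size.
apply: (@leq_trans #|[predU (y :: u) & P]|).
  apply/subset_leq_card/subsetP => x /andP[xy]; rewrite !inE.
  by move=> /orP[|xu]; [rewrite inE => -> | rewrite xy xu orbT].
apply: (@leq_trans (#|y :: u| + #|P|)); first by rewrite -cardUI leq_addr.
by apply: leq_trans (leq_add U_le P_le) _; lia.
Qed.

(* The rainbow Turan bound ex*(n, C_2k) = O(n^(1 + 1/k)). *)
Lemma exists_even_rainbow_cycle E c (k nu : nat) : 0 < k ->
  sgraph E -> proper_edge_coloring E c -> #|T| <= nu ^ k ->
  16 * k ^ 2 * (2 * k).+1 * nu * #|T| < #|E| ->
  exists2 s, size s = 2 * k & rainbow_cycle E c s.
Proof.
case: k => // m _ gE0 cE0 T_nu /exists_min_degree_subgraph[E' [sub E'_neq0 deg_gt]].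
have gE := sgraph_sub sub gE0; have cE := proper_sub sub cE0.
have bad_card (y : T) (u : m.+1.-tuple T) : path (adj E') y u ->
    #|[pred x | adj E' x y && collides c y u x]| <= (2 * m.+1).+1.
  by move=> _; have := card_collides y u gE cE; rewrite size_tuple.
have [x0 [y0 xy0]] : exists x y, adj E' x y.
  have /set0Pn[A AE] := E'_neq0; have /cards2P[a [b [_ defA]]] := forall_inP gE A AE.
  by exists a, b; rewrite /adj -defA.
have [] := @exists_good_closed_walk T (adj E') m nu _ _ (adj_sym E')
  (ex_intro _ x0 (ex_intro _ y0 xy0)) bad_card T_nu (ltnSn _).
  move=> x y xy; apply: leq_trans (degree_le_neighbours x gE); apply: deg_gt.
  by apply/bigcupP; exists [set x; y]; rewrite ?set21.
move=> s [sz_s cyc_s] s_good; exists s => //.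
apply: (rainbow_cycle_sub sub); apply/and3P; split=> //.
- apply: (@uniq_rot_last _ x0 m.+1); first by rewrite sz_s.
  move=> i si; have := s_good i si; case: (rot i.+1 s) => //= y p.
  rewrite negb_or => /andP[+ _]; apply: contra; rewrite !inE.
  case/predU1P => [->|yp]; first by rewrite eqxx.
  rewrite -(take_takel p (leqnSn m)) in yp.
  by rewrite (mem_take yp) orbT.
(* In each rotation the last colour is that of the closing edge, and the first [m.+1] are those of
   the walk against which [collides] tests it. *)
apply: (@uniq_rot_last _ 0 m.+1); rewrite size_cycle_colors ?sz_s //.
move=> i si; have := s_good i; rewrite sz_s => /(_ si).
rewrite -cycle_colors_rot ?sz_s //.
have := size_rot i.+1 s; rewrite sz_s; case: (rot i.+1 s) => //= y p sz_p.
rewrite negb_or => /andP[_]; rewrite path_colors_rcons last_rcons.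
apply: contra.
have -> : take m.+1 (rcons (path_colors c y p) (c [set last y p; y]))
    = take m.+1 (path_colors c y p).
  by rewrite -cats1 takel_cat // size_pairmap; lia.
rewrite -{2}(cat_take_drop m.+1 p) path_colors_cat take_size_cat //.
by rewrite size_pairmap size_takel //; lia.
Qed.

End Rainbow.

(** * Triangles *)

Lemma eq_set2 (T : finType) (a b x y : T) :
  [set a; b] = [set x; y] -> a = x /\ b = y \/ a = y /\ b = x.
Proof.
move=> eqS; have := set21 a b; have := set22 a b; rewrite eqS !inE.
have := set21 x y; have := set22 x y; rewrite -eqS !inE.
by do 4 (move=> /orP[] /eqP ?); subst; auto.
Qed.

(** Adding any subset of the complement of [S1 :|: S2] to [S1] gives such a [Z]; so a uniformly
    random [Z] qualifies with probability at least 2^-n. *)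
Lemma card_sets_between (U : finType) (S1 S2 : {set U}) (n : nat) :
  [disjoint S1 & S2] -> #|S1 :|: S2| <= n ->
  2 ^ #|U| <= 2 ^ n * #|[set Z : {set U} | (S1 \subset Z) && [disjoint Z & S2]]|.
Proof.
move=> dis12 le_n; set S := S1 :|: S2 in le_n; set F := [set Z | _].
have F_ge : 2 ^ #|~: S| <= #|F|.
  rewrite -card_powerset -(@card_in_imset _ _ (fun Y => S1 :|: Y)).
    apply/subset_leq_card/subsetP => Z /imsetP[Y]; rewrite !inE => Y_sub ->.
    rewrite subsetUl disjoints_subset subUset -disjoints_subset dis12 /=.
    by rewrite (subset_trans Y_sub) // setCS subsetUr.
  move=> Y Y'; rewrite !inE => Y_sub Y'_sub eqU.
  have setD_U (X : {set U}) : X \subset ~: S -> (S1 :|: X) :\: S1 = X.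
    move=> X_sub; rewrite setDUl setDv set0U; apply/setDidPl.
    rewrite disjoints_subset (subset_trans X_sub) // setCS subsetUl //.
  by rewrite -(setD_U Y) // eqU setD_U.
rewrite -(cardsC S) expnD leq_mul // leq_exp2l //.
Qed.

Section Triangles.

Variable T : finType.
Implicit Types (E G : {set {set T}}) (c : {set T} -> nat) (s p : seq T).

(* The closing edge of [y :: p] is replaced by the path through [w]. *)
Lemma rainbow_cycle_extend E c y p w :
  sgraph E -> proper_edge_coloring E c ->
  uniq (y :: p) -> path (adj E) y p -> uniq (path_colors c y p) ->
  last y p != y -> w \notin y :: p -> adj E (last y p) w -> adj E w y ->
  c [set last y p; w] \notin path_colors c y p ->
  c [set w; y] \notin path_colors c y p ->
  rainbow_cycle E c (rcons (y :: p) w).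
Proof.
move=> gE cE uniq_p path_p uniq_c last_neq w_notin adj1 adj2 c1 c2.
apply/and3P; split; first by rewrite rcons_uniq w_notin.
  by rewrite rcons_cons /= !rcons_path path_p last_rcons adj1.
rewrite rcons_cons /= !path_colors_rcons last_rcons !rcons_uniq c1 uniq_c.
rewrite mem_rcons inE negb_or c2 !andbT; apply: contra_neqN last_neq.
rewrite setUC => /eqP eqc.
by apply: (color_inj gE cE adj1 _ (esym eqc)); rewrite adj_sym.
Qed.

Lemma exists_rainbow_cycle_of_codegree E c m : 1 < m ->
  sgraph E -> proper_edge_coloring E c -> E != set0 ->
  (forall x y, adj E x y -> 3 * m < #|[pred w | adj E x w && adj E w y]|) ->
  exists2 s, size s = m.+1 & rainbow_cycle E c s.
Proof.
move=> m_gt1 gE cE E_neq0 codeg.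
(* The closing edge may repeat a colour, since it is the edge to be replaced; thus a single edge,
   closed by itself, is a valid start. *)
pose almost y p := [&& uniq (y :: p), path (adj E) y p,
  uniq (path_colors c y p) & adj E (last y p) y].
have step y p : size p < m -> almost y p ->
    exists w, rainbow_cycle E c (rcons (y :: p) w).
  move=> sz_p /and4P[uniq_p path_p uniq_c adj_y].
  have last_neq := adj_neq gE adj_y.
  pose x := last y p.
  (* [B1] catches repeated vertices and a repeated colour on the edge to [y], [B2] a repeated colour
     on the edge to [x]; together at most [3 * size p + 1 <= 3 * m] vertices. *)
  pose B1 := [pred w | adj E w y && collides c y p w].
  pose B2 := [pred w | adj E w x && (c [set w; x] \in path_colors c y p)].
  have B1_le : #|B1| <= (2 * size p).+1 := card_collides y p gE cE.
  have B2_le : #|B2| <= size p.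
    by have := card_color_mem x (path_colors c y p) gE cE; rewrite size_pairmap.
  have [w] : exists w, w \in [predD [pred w | adj E x w && adj E w y] & [predU B1 & B2]].
    apply/card_gt0P; rewrite -(ltn_add2l #|[predU B1 & B2]|) addn0.
    apply: (@leq_trans (3 * m).+1).
      apply: leq_ltn_trans (_ : 3 * m < _) => //.
      apply: leq_trans (leq_trans _ (leq_add B1_le B2_le)) _; last lia.
      by rewrite -cardUI leq_addr.
    apply: leq_trans (codeg x y adj_y) _.
    rewrite -cardUI; apply: leq_trans (leq_addr _ _).
    by apply/subset_leq_card/subsetP => w; rewrite !inE => ->; rewrite andbT orbN.
  case/andP => /norP[wB1 wB2] /andP[xw wy].
  have : ~~ collides c y p w by apply: contra wB1 => coll; apply/andP.
  rewrite negb_or => /andP[w_notin c2].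
  have c1 : c [set x; w] \notin path_colors c y p.
    apply: contra wB2 => col; apply/andP; rewrite adj_sym; split=> //.
    by rewrite setUC.
  by exists w; apply: rainbow_cycle_extend.
have grow j : 1 < j <= m -> exists y p, size p = j.-1 /\ almost y p.
  elim: j => // j IHj /andP[j_gt0 j_le].
  have [j1|j_gt1] := leqP j 1.
    have /set0Pn[A AE] := E_neq0; have /cards2P[a [b [ab defA]]] := forall_inP gE A AE.
    exists a, [:: b]; split; first by rewrite /=; lia.
    by rewrite /almost /= inE ab [adj E b a]adj_sym /adj -defA AE.
  have [|y [p [sz_p almost_p]]] := IHj; first by rewrite j_gt1 ltnW.
  have [|w /and3P[uniq_w]] := step y p _ almost_p; first by lia.
  rewrite rcons_cons /= !rcons_path path_colors_rcons rcons_uniq last_rcons.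
  move=> /andP[path_w adj_w] /andP[_ uniq_c].
  exists y, (rcons p w); rewrite size_rcons sz_p; split; first by lia.
  by rewrite /almost last_rcons -rcons_cons uniq_w uniq_c adj_w rcons_path path_w.
have [|y [p [sz_p almost_p]]] := grow m; first by rewrite m_gt1 leqnn.
have [|w rainbow_w] := step y p _ almost_p; first by lia.
by exists (rcons (y :: p) w) => //; rewrite size_rcons /= sz_p; lia.
Qed.

(* Ordered triples: each triangle is counted six times. *)
Definition triangles E : {set T * T * T} :=
  [set t | [&& adj E t.1.1 t.1.2, adj E t.1.2 t.2 & adj E t.2 t.1.1]].

(** A lost triple has [x] and [y] in two of its three places, in one of six ways, and a common
    neighbour of both in the third. *)
Lemma triangles_delete_edge E x y n :
  #|[pred w | adj E x w && adj E w y]| <= n ->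
  #|triangles E| <= #|triangles (E :\ [set x; y])| + 6 * n.
Proof.
set W := [pred w | _] => W_le.
have im_le (f : T -> T * T * T) : #|[set f w | w in W]| <= n.
  exact: leq_trans (leq_imset_card _ _) W_le.
have U_le (A B : {set T * T * T}) a b : #|A| <= a -> #|B| <= b -> #|A :|: B| <= a + b.
  by move=> Aa Bb; apply: leq_trans (leq_card_setU _ _) (leq_add Aa Bb).
pose L := [set (x, y, w) | w in W] :|: [set (y, x, w) | w in W]
  :|: [set (x, w, y) | w in W] :|: [set (y, w, x) | w in W]
  :|: [set (w, x, y) | w in W] :|: [set (w, y, x) | w in W].
have L_le : #|L| <= 6 * n.
  have -> : 6 * n = n + n + n + n + n + n by lia.
  by do 5 (apply: (@U_le) => //).
apply: leq_trans (leq_add (leqnn _) L_le); apply: leq_trans (leq_card_setU _ _).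
apply/subset_leq_card/subsetP => -[[a b] z].
rewrite [in X in X -> _]inE /= => /and3P[ab bz za].
rewrite inE; have [//|t_notin] := boolP (_ \in triangles _).
move: t_notin; rewrite inE /adj !in_setD1 /= -!/(adj E _ _) ab bz za !andbT.
have inW w : adj E x w -> adj E w y -> w \in W by move=> xw wy; rewrite !inE xw wy.
have inW' w : adj E y w -> adj E w x -> w \in W.
  by move=> yw wx; rewrite inW // adj_sym.
rewrite !negb_and !negbK => /or3P[] /eqP/eq_set2[] [? ?]; subst;
  rewrite /L !in_setU; do !(apply/orP; (by right; apply: imset_f; auto) || left);
  by apply: imset_f; auto.
Qed.

(* In a smallest subgraph with more than [18 * m] triangles per edge, every edge
   lies in many triangles, so cycles can be lengthened greedily. *)
Lemma card_triangles_le E c m : 1 < m ->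
  sgraph E -> proper_edge_coloring E c ->
  ~ (exists2 s, size s = m.+1 & rainbow_cycle E c s) ->
  #|triangles E| <= 18 * m * #|E|.
Proof.
move=> m_gt1 gE0 cE0 no_rainbow; rewrite leqNgt; apply/negP => tri_gt.
pose P E' := (E' \subset E) && (18 * m * #|E'| < #|triangles E'|).
have PE : P E by rewrite /P subxx.
case: (arg_minnP (fun E' : {set {set T}} => #|E'|) PE) => E' /andP[sub E'_gt] E'_min.
have gE := sgraph_sub sub gE0; have cE := proper_sub sub cE0.
apply: no_rainbow.
have [||s sz_s rainbow_s] :=
    exists_rainbow_cycle_of_codegree m_gt1 gE cE.
- apply: contraTneq E'_gt => ->; rewrite cards0 muln0 -leqNgt leqn0 cards_eq0.
  by apply/eqP/setP => t; rewrite !inE /adj !inE.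
(* Deleting an edge with at most [3 * m] common neighbours loses at most [18 * m] ordered triples,
   which contradicts minimality. *)
- move=> x y xy; rewrite ltnNge; apply/negP => /triangles_delete_edge tri_le.
  have card_E' : #|E'| = #|E' :\ [set x; y]|.+1 by rewrite (cardsD1 [set x; y]) (xy : _ \in E').
  have /E'_min : P (E' :\ [set x; y]).
    rewrite /P (subset_trans (subsetDl _ _) sub) /=.
    have n_eq : 6 * (3 * m) = 18 * m by lia.
    move: E'_gt; rewrite card_E' mulnS => /leq_trans /(_ tri_le).
    by rewrite n_eq addnC ltn_add2r.
  by rewrite card_E' ltnn.
by exists s => //; apply: rainbow_cycle_sub rainbow_s.
Qed.

End Triangles.

(** * From even to odd rainbow cycles by a random split *)

Section EvenCycleToOdd.

Variable T : finType.
Implicit Types (E G : {set {set T}}) (c : {set T} -> nat) (s p : seq T).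

Definition triangle_edges G : {set {set T}} :=
  [set A in G | [exists x, exists y, exists w,
    [&& A == [set x; y], adj G x w & adj G w y]]].

Lemma triangle_edges_sub G : triangle_edges G \subset G.
Proof. by apply/subsetP => A; rewrite inE => /andP[]. Qed.

(** No triangle is lost, so it is enough to bound the number of edges lying in triangles. *)
Lemma triangles_triangle_edges G : triangles G \subset triangles (triangle_edges G).
Proof.
have in_edges a b z : adj G a b -> adj G b z -> adj G z a -> adj (triangle_edges G) a b.
  move=> ab bz za; rewrite /adj inE [_ \in G]ab /=; apply/existsP; exists a.
  apply/existsP; exists b; apply/existsP; exists z.
  by rewrite eqxx adj_sym za adj_sym bz.
apply/subsetP => -[[a b] z]; rewrite 2!inE /= => /and3P[ab bz za].
by rewrite (in_edges a b z) // (in_edges b z a) // (in_edges z a b).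
Qed.

(* A rainbow cycle in [split_graph G c col Z] has its vertices and its colours
   in [Z], while each of its edges lies in a triangle of [G] whose apex and
   whose two other colours avoid [Z]. *)
Definition split_graph (C : finType) G (col : {set T} -> C) (Z : {set T + C}) :
    {set {set T}} :=
  [set A in G | [exists x, exists y, exists w,
    [&& A == [set x; y], adj G x w, adj G w y,
      [set inl x; inl y; inr (col A)] \subset Z &
      [disjoint Z & [set inl w; inr (col [set x; w]); inr (col [set w; y])]]]]].

(** The closing edge is replaced by the detour through the apex of its triangle. The apex and the
    two new colours avoid [Z], which contains all vertices and colours of the cycle, so nothing
    repeats. *)
Lemma split_graph_cycle (C : finType) (col : {set T} -> C) G c Z m :
  sgraph G -> proper_edge_coloring G c ->
  {in G &, forall A B, c A = c B -> col A = col B} ->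
  (exists2 s, size s = m.+1 & rainbow_cycle (split_graph G col Z) c s) ->
  exists2 s, size s = m.+2 & rainbow_cycle G c s.
Proof.
move=> gG cG colP [[|y p] //= [sz_p] /and3P[uniq_p cyc_p uniq_c]].
set H := split_graph G col Z in cyc_p.
have sub : H \subset G by apply/subsetP => A; rewrite inE => /andP[].
have H_in a b : adj H a b -> [/\ inl a \in Z, inl b \in Z & inr (col [set a; b]) \in Z].
  rewrite /adj inE => /andP[_ /existsP[x /existsP[z /existsP[w]]]].
  move=> /and5P[/eqP eqS _ _ + _].
  rewrite !subUset !sub1set => /andP[/andP[xZ zZ] ->].
  by have [[-> ->]|[-> ->]] := eq_set2 eqS.
move: (cyc_p) uniq_c; rewrite /= rcons_path => /andP[path_p adj_y].
rewrite path_colors_rcons rcons_uniq => /andP[_ uniq_c].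
have vertex_Z v : v \in y :: p -> inl v \in Z.
  move=> v_in; have : cycle (adj H) (y :: p) by [].
  by move=> /next_cycle /(_ v_in) /H_in[].
have color_Z A : A \in G -> c A \in path_colors c y p -> inr (col A) \in Z.
  move=> AG; elim: p y path_p {sz_p uniq_p cyc_p adj_y uniq_c vertex_Z} => //= z p IHp y.
  move=> /andP[yz path_p]; rewrite inE => /predU1P[cA|]; last exact: IHp.
  have [_ _ +] := H_in y z yz; congr (inr _ \in Z).
  by apply: colP => //; apply: (subsetP sub).
have adjH_G a b : adj H a b -> adj G a b by apply: (subsetP sub).
move: (adj_y); rewrite {1}/adj inE => /andP[_ /existsP[a /existsP[b /existsP[w]]]].
move=> /and5P[/eqP eqS aw wb _].
rewrite disjoint_sym disjoints_subset !subUset !sub1set !inE.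
move=> /andP[/andP[wZ awZ] wbZ].
have [xw wy xwZ wyZ] : [/\ adj G (last y p) w, adj G w y,
    inr (col [set last y p; w]) \notin Z & inr (col [set w; y]) \notin Z].
  have [[-> ->]|[-> ->]] := eq_set2 eqS; first by [].
  by split; rewrite 1?adj_sym // setUC.
exists (rcons (y :: p) w); first by rewrite size_rcons /= sz_p.
apply: rainbow_cycle_extend => //.
- by apply: sub_path path_p => u v; apply: adjH_G.
- exact: adj_neq gG (adjH_G _ _ adj_y).
- by apply: contra wZ; apply: vertex_Z.
- by apply: contra xwZ; apply: color_Z.
- by apply: contra wyZ; apply: color_Z.
Qed.

(** Double counting of pairs of an edge and a set [Z]. For a fixed triangle on the edge, [Z] has to
    contain three elements and avoid three others, disjoint from these by properness; this has
    probability at least 2^-6. *)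
Lemma sum_split_graph (C : finType) G c (col : {set T} -> C) :
  sgraph G -> proper_edge_coloring G c ->
  {in G &, forall A B, col A = col B -> c A = c B} ->
  #|triangle_edges G| * 2 ^ #|{: T + C}|
    <= 64 * \sum_(Z : {set T + C}) #|split_graph G col Z|.
Proof.
move=> gG cG colP.
have -> : \sum_(Z : {set T + C}) #|split_graph G col Z|
    = \sum_A #|[set Z | A \in split_graph G col Z]|.
  rewrite (eq_bigr (fun Z => \sum_(A in split_graph G col Z) 1)) => [|Z _].
    rewrite (exchange_big_dep xpredT) //=; apply: eq_bigr => A _.
    by rewrite sum1dep_card.
  by rewrite sum1_card.
rewrite big_distrr /= -sum_nat_const [leqRHS](bigID (mem (triangle_edges G))) /=.
apply: leq_trans (leq_addr _ _); apply: leq_sum => A.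
rewrite inE => /andP[AG /existsP[x /existsP[y /existsP[w /and3P[/eqP defA xw wy]]]]].
have xy : adj G x y by rewrite /adj -defA.
have [xy_neq xw_neq wy_neq] := And3 (adj_neq gG xy) (adj_neq gG xw) (adj_neq gG wy).
have col1 : col A != col [set x; w].
  apply: contraNneq wy_neq => /colP; rewrite defA => /(_ xy xw).
  rewrite ![[set x; _]]setUC => /(color_inj gG cG) ->; rewrite ?eqxx //.
    by rewrite adj_sym.
  by rewrite adj_sym.
have col2 : col A != col [set w; y].
  apply: contraNneq xw_neq => /colP; rewrite defA => /(_ xy wy).
  by move=> /(color_inj gG cG xy wy) ->.
pose S1 : {set T + C} := [set inl x; inl y; inr (col A)].
pose S2 : {set T + C} := [set inl w; inr (col [set x; w]); inr (col [set w; y])].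
have dis : [disjoint S1 & S2].
  rewrite disjoints_subset !subUset !sub1set !inE !negb_or.
  by rewrite !(inj_eq inl_inj) !(inj_eq inr_inj) xw_neq (eq_sym y) wy_neq col1 col2.
have card3 (a b d : T + C) : #|[set a; b; d]| <= 3.
  by apply: leq_trans (leq_card_setU _ _) _; rewrite cards1 cards2; case: (a != b).
have card6 : #|S1 :|: S2| <= 6.
  by apply: leq_trans (leq_card_setU _ _) (leq_add (card3 _ _ _) (card3 _ _ _)).
apply: leq_trans (card_sets_between dis card6) _; rewrite leq_mul //.
apply/subset_leq_card/subsetP => Z; rewrite !inE AG => /andP[S1Z S2Z].
apply/existsP; exists x; apply/existsP; exists y; apply/existsP; exists w.
by rewrite {1}defA eqxx xw wy S1Z.
Qed.

Lemma card_triangle_edges_le (B : nat) G c m :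
  sgraph G -> proper_edge_coloring G c ->
  (forall H : {set {set T}}, H \subset G ->
    ~ (exists2 s, size s = m.+1 & rainbow_cycle H c s) -> #|H| <= B) ->
  ~ (exists2 s, size s = m.+2 & rainbow_cycle G c s) ->
  #|triangle_edges G| <= 64 * B.
Proof.
move=> gG cG B_max no_rainbow.
(* Coding the finitely many values of [c] in an ordinal leaves finitely many sets [Z] to average
   over. *)
pose N := \max_(A : {set T}) c A; pose col A : 'I_N.+1 := inord (c A).
have val_col A : col A = c A :> nat by rewrite inordK // ltnS (leq_bigmax A).
rewrite -(@leq_pmul2r (2 ^ #|{: T + 'I_N.+1}|)) ?expn_gt0 //.
apply: leq_trans (@sum_split_graph _ G c col gG cG _) _.
  by move=> A A' _ _ /(congr1 val) /=; rewrite !val_col.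
rewrite -mulnA leq_mul2l /=; apply: (@leq_trans (\sum_(Z : {set T + 'I_N.+1}) B)).
  apply: leq_sum => Z _; apply: B_max.
    by apply/subsetP => A; rewrite inE => /andP[].
  move=> rainbow_s; apply: no_rainbow.
  apply: (split_graph_cycle gG cG _ rainbow_s) => A A' _ _ eqc.
  by apply: val_inj; rewrite /= !val_col.
by rewrite sum_nat_const mulnC -cardsT -powersetT card_powerset cardsT.
Qed.

(** * Copies of cycles and the final bound *)

Lemma rainbow_cycle_copy G c s m : size s = m -> 0 < m ->
  rainbow_cycle G c s -> has_rainbow_copy (cycle_graph m) G c.
Proof.
case: s => [<-//|y p] sz_m m_gt0 /and3P[uniq_s cyc_s uniq_c].
have sz_p : size p = m.-1 by rewrite -sz_m.
have nth_next i : i < m -> nth y (rcons p y) i = nth y (y :: p) (i.+1 %% m).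
  move=> im; rewrite nth_rcons sz_p; case: ltngtP => ip; last 2 first.
  - by lia.
  - have -> : i.+1 = m by lia.
    by rewrite modnn.
  by rewrite modn_small //; lia.
have nth_edge i : i < m -> adj G (nth y (y :: p) i) (nth y (y :: p) (i.+1 %% m)).
  move=> im; have := pathP y cyc_s i; rewrite size_rcons sz_p prednK // => /(_ im).
  by rewrite nth_next // -rcons_cons nth_rcons sz_m im.
have nth_color i : i < m -> nth 0 (cycle_colors c (y :: p)) i
    = c [set nth y (y :: p) i; nth y (y :: p) (i.+1 %% m)].
  move=> im; rewrite /= (nth_pairmap y) ?size_rcons ?sz_p ?prednK //.
  by rewrite nth_next // -rcons_cons nth_rcons sz_m im.
pose f := [ffun i : 'I_m => nth y (y :: p) i].
have f_edge i : f @: [set i; ordS i] = [set nth y (y :: p) i; nth y (y :: p) (i.+1 %% m)].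
  by rewrite imsetU !imset_set1 !ffunE.
exists (f @: [set: 'I_m], [set f @: (A : {set 'I_m}) | A in cycle_graph m]).
  apply: imset_f; rewrite inE; apply/andP; split.
    apply/injectiveP => i j; rewrite !ffunE => /eqP.
    by rewrite nth_uniq ?sz_m // => /eqP /val_inj.
  apply/subsetP => _ /imsetP[_ /imsetP[i _ ->] ->].
  by rewrite f_edge; apply: nth_edge.
move=> _ _ /imsetP[_ /imsetP[i _ ->] ->] /imsetP[_ /imsetP[j _ ->] ->].
rewrite !f_edge -!nth_color // => /eqP.
by rewrite nth_uniq ?size_cycle_colors ?sz_m // => /eqP ->.
Qed.

(** Each copy is the image of an embedding, and an embedding is determined by the ordered triple of
    its values. *)
Lemma card_triangle_copies G :
  #|copies (cycle_graph 3) G| <= #|triangles G|.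
Proof.
apply: leq_trans (leq_imset_card _ _) _.
pose i0 : 'I_3 := ord0; pose i1 := ordS i0; pose i2 := ordS i1.
have i2S : ordS i2 = i0 by apply: val_inj.
pose g (f : {ffun 'I_3 -> T}) := (f i0, f i1, f i2).
have g_inj : injective g.
  move=> f f' [e0 e1 e2]; apply/ffunP => i.
  have : i \in [:: i0; i1; i2] by case: i => [[|[|[|]]]].
  by rewrite !inE => /or3P[]/eqP ->.
rewrite -(card_imset _ g_inj); apply/subset_leq_card/subsetP => t.
case/imsetP => f; rewrite inE => /andP[_ sub] ->.
have f_adj i : adj G (f i) (f (ordS i)).
  apply: (subsetP sub); apply/imsetP; exists [set i; ordS i].
    by apply/imsetP; exists i.
  by rewrite imsetU !imset_set1.
have := f_adj i2; rewrite i2S => f20.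
by rewrite inE /= (f_adj i0) (f_adj i1) f20.
Qed.

End EvenCycleToOdd.

(** The constants multiply: [18 * (2 * k)] from the passage to edges in triangles, 64 from the
    random split, and the rest from the bound for even rainbow cycles. *)
Lemma card_copies_rainbow_free (n k nu : nat) (G : {set {set 'I_n}}) : 1 < k ->
  n <= nu ^ k -> sgraph G -> rainbow_free_colorable (cycle_graph (2 * k + 1)) G ->
  #|copies (cycle_graph 3) G|
    <= 36 * k * (64 * (16 * k ^ 2 * (2 * k).+1 * nu * n)).
Proof.
move=> k_gt1 n_nu gG [c cG free].
have no_rainbow (E : {set {set 'I_n}}) : E \subset G ->
    ~ exists2 s, size s = (2 * k).+1 & rainbow_cycle E c s.
  move=> sub [s sz_s rainbow_s]; apply: free; rewrite addn1.
  by apply: (rainbow_cycle_copy sz_s) => //; apply: rainbow_cycle_sub rainbow_s.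
have sub1 := triangle_edges_sub G.
apply: leq_trans (card_triangle_copies G) _.
apply: leq_trans (subset_leq_card (triangles_triangle_edges G)) _.
apply: leq_trans (card_triangles_le _ (sgraph_sub sub1 gG) (proper_sub sub1 cG)
  (no_rainbow _ sub1)) _; first by lia.
have -> : 18 * (2 * k) = 36 * k by lia.
rewrite leq_mul2l; apply/orP; right.
have k2 : (2 * k).-1.+1 = 2 * k by lia.
apply: (@card_triangle_edges_le _ _ G c (2 * k).-1) => //; rewrite k2; last first.
  exact: no_rainbow.
move=> H subH no_even; rewrite leqNgt; apply/negP => H_gt; apply: no_even.
apply: (exists_even_rainbow_cycle (nu := nu) _ (sgraph_sub subH gG) (proper_sub subH cG)).
- exact: ltnW.
- by rewrite card_ord.
- by rewrite card_ord.
Qed.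

Local Open Scope ring_scope.

Theorem theorem1p2 (R : realType) (k : nat) (hk : (2 <= k)%N) :
  exists c : R, forall n : nat,
    (rainbow_ex n (cycle_graph 3) (cycle_graph (2 * k + 1)))%:R
      <= c * n%:R `^ (1 + 1 / k%:R).
Proof.
pose C := (36 * k * 64 * (16 * k ^ 2 * (2 * k).+1))%N.
(* The factor 2 pays for rounding: [nu] is the integer part of n^(1/k) plus 1, at most 2 n^(1/k)
   once n >= 1. *)
exists (2 * C%:R) => n.
have ex_le nu : (n <= nu ^ k)%N ->
    (rainbow_ex n (cycle_graph 3) (cycle_graph (2 * k + 1)) <= C * nu * n)%N.
  move=> n_nu; apply/bigmax_leqP => G /andP[gG /asboolP free].
  by have := card_copies_rainbow_free hk n_nu gG free; rewrite /C !mulnA.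
have k_neq0 : k%:R != 0 :> R by rewrite pnatr_eq0 -lt0n ltnW.
(* For [n = 0] the root is 0 and the rounding estimate fails; [nu = 1] shows that the left side
   vanishes. *)
have [n0|n_gt0] := posnP n.
  have := ex_le 1%N; rewrite n0 muln0 leqn0 => /(_ isT)/eqP ->.
  by rewrite mulr_ge0 ?mulr_ge0 ?powR_ge0.
set x : R := n%:R `^ (1 / k%:R).
have n_ge1 : 1 <= n%:R :> R by rewrite ler1n.
have x_ge1 : 1 <= x.
  have <- : 1 `^ (1 / k%:R) = 1 :> R by rewrite powR1.
  by apply: ge0_ler_powR; rewrite ?nnegrE ?divr_ge0.
have x_ge0 : 0 <= x by apply: powR_ge0.
have /andP[trunc_le trunc_gt] := truncn_itv x_ge0.
have xk : x ^+ k = n%:R.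
  by rewrite -powR_mulrn // -powRrM div1r mulVf // powRr1.
have /ex_le : (n <= (Num.truncn x).+1 ^ k)%N.
  by rewrite -(ler_nat R) natrX -xk lerXn2r ?nnegrE // ltW.
rewrite -(ler_nat R) => /le_trans; apply.
rewrite powRD ?(gt_eqF (lt_le_trans ltr01 n_ge1)) ?implybT // powRr1 // -/x.
have nu_le : (Num.truncn x).+1%:R <= 2 * x.
  have -> : 2 * x = x + x by ring.
  by rewrite -natr1; apply: lerD.
have -> : 2 * C%:R * (n%:R * x) = C%:R * (2 * x) * n%:R by ring.
by rewrite natrM ler_wpM2r ?ler0n // natrM ler_wpM2l ?ler0n.
Qed.
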